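(* Let $(X,d,|\cdot|)$ be a space of homogeneous type with a fixed system $\mathscr Q$ of dyadic cubes. Let $C_R>0$ and $\mu\in\mathbb N$ be such that $$4K_X^3\,(1+C_2/C_R)\,q^{\mu}\le 1 .$$ Let $\mathscr A\subset\mathscr Q$ be a finite collection of cubes satisfying: (1) (separation condition) $(C_R\diamond A_1)\cap(C_R\diamond A_2)=\emptyset$ for all $A_1\ne A_2$ in $\mathscr A$ with $\operatorname{lev}A_1=\operatorname{lev}A_2$; (2) (small successor condition) $\operatorname{lev}A\ge\mu+\operatorname{lev}\pi(A)$ for all $A\in\mathscr A^{(\alpha)}$, where $\alpha=2K_X^3(C_2+C_R)+C_R/2$ and $\pi=\pi_{\mathscr A^{(\alpha)}}$ is the predecessor with respect to $\mathscr A^{(\alpha)}$. Let $\varphi:\mathscr A\to\mathscr P(\mathscr A)$ (the power set of $\mathscr A$) be a map such that $$\operatorname{lev}Q>\operatorname{lev}A\quad\text{for all }A\in\mathscr A,\ Q\in\varphi(A),\qquad\text{and}\qquad \varphi(A)^*\subset\frac{C_R}{2K_X}\diamond A\quad\text{for all }A\in\mathscr A .$$ Then there exist a collection $\mathscr B$ of (adapted) cubes in $X$, i.e. of subsets of $X$, and a bijective map $\sigma:\mathscr A\to\mathscr B$ such that for all $A\in\mathscr A$ $$A\cup\sigma(\varphi(A))^*\subset\sigma(A)\subset C_R\diamond A$$ and $$|\sigma(A)|\le C_d\Big(\frac{K_X(C_2+C_R)}{C_1}\Big)^{\log_2(C_d)}|A| .$$ Moreover, the collection $\mathscr B=\{\sigma(A):A\in\mathscr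 A\}$ is nested.
   Context: Space of homogeneous type: $X$ is a set with a quasimetric $d:X\times X\to[0,\infty)$, i.e. $d(x,y)=0\Leftrightarrow x=y$, $d(x,y)=d(y,x)$, $d(x,y)\le K_X(d(x,z)+d(z,y))$ with a constant $K_X\ge1$. $B(x,r)=\{y\in X:d(x,y)<r\}$. A set $A\subset X$ is open if for every $x\in A$ there is $r>0$ with $B(x,r)\subset A$; all balls are assumed open. $|\cdot|$ is a Borel measure satisfying the doubling condition $0<|B(x,2r)|\le C_d|B(x,r)|<\infty$ for all $x\in X$, $r>0$. For $A\subset X$: $d(A,y)=\inf_{a\in A}d(a,y)$ and $B(A,r)=\{y\in X:d(A,y)<r\}$. Dyadic cubes: $\mathscr Q=\bigcup_{n\in\mathbb Z}\mathscr Q_n$ is a fixed system of open subsets of $X$ (the Christ/David dyadic cubes), with centers $m_A\in A$ for $A\in\mathscr Q$ and constants $0<q<1$, $C_1,C_2,C_3,\eta>0$, $N\in\mathbb N$ such that: (1) $X=\bigcup_{A\in\mathscr Q_n}A$ up to null sets for each $n$; (2) for $A\in\mathscr Q_k$, $B\in\mathscr Q_n$, $k\le n$, either $B\subset A$ or $A\cap B=\emptyset$; (3) for $B\in\mathscr Q_n$ and $k\le n$ there is exactly one $A\in\mathscr Q_k$ with $B\subset A$; (4) $B(m_A,C_1q^n)\subset A\subset B(m_A,C_2q^n)$ for $A\in\mathscr Q_n$; (5) for $A\in\mathscr Q_n$, $\partial_tA=\{x\in A:d(x,X\setminus A)\le tq^n\}$ satisfies $|\partial_tA|<C_3t^\eta|A|$;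 (6) each $\mathscr Q_n$ is countable; (7) each $A\in\mathscr Q_n$ contains at most $N$ cubes of $\mathscr Q_{n+1}$; (8) each $A\in\mathscr Q_n$ is, up to null sets, a union of at most $N$ cubes of $\mathscr Q_{n+1}$. Level and dilation: $\operatorname{lev}A=n$ for $A\in\mathscr Q_n$. A cube is understood together with its level, and for cubes $C\subsetneq D$ is understood as $C\subset D$ and $\operatorname{lev}D<\operatorname{lev}C$. For $r>0$, $r\diamond A=B(A,rq^{\operatorname{lev}A})$. For a collection $\mathscr A\subset\mathscr Q$ and $\alpha>0$, $\mathscr A^{(\alpha)}=\bigcup_{A\in\mathscr A}\{Q\in\mathscr Q_{\operatorname{lev}A}:Q\cap(\alpha\diamond A)\ne\emptyset\}$. For a collection $\mathscr C$ of sets, $\mathscr C^*$ denotes the union of its members. $\mathscr C$ is nested if $A\cap B\in\{A,B,\emptyset\}$ for all $A,B\in\mathscr C$. For nested $\mathscr C$ and $C\in\mathscr C$, the predecessor is $\pi_{\mathscr C}(C)=\bigcap\{D:D\supsetneq C,\ D\in\mathscr C\cup\{X\}\}$; if no member of $\mathscr C$ strictly contains $C$ (so that $\pi_{\mathscr C}(C)=X$) we put $\operatorname{lev}\pi_{\mathscr C}(C)=-\infty$, so the small successor condition is vacuous for such $C$. $\sigma(\varphi(A))=\{\sigma(Q):Q\in\varphi(A)\}$. An adapted cube $\sigma(A)$ is regarded together with its level $\operatorname{lev}\sigma(A)=\operatorname{lev}A$, i.e. $\mathscr B$ is the family of sets $\sigma(A)$ indexed by $A\in\mathscr A$.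
   Formalization: The inner and outer radius constants of the dyadic cubes are assumed to satisfy C_1 ≤ C_2; without this the measure bound fails, e.g. on a one-point space with C_d = 2, C_1 = 100, C_2 = C_R = 1. *)

(* Defs.v *)
From HB Require Import structures.
From mathcomp Require Import all_boot all_order all_algebra.
From mathcomp Require Import all_classical all_reals all_analysis.

Set Implicit Arguments.
Unset Strict Implicit.
Unset Printing Implicit Defensive.

Import Order.TTheory GRing.Theory Num.Theory.

Local Open Scope classical_set_scope.
Local Open Scope card_scope.
Local Open Scope ring_scope.

Section Quasimetric.
Variables (R : realType) (X : pointedType) (d : X -> X -> R).
Implicit Types (A : set X) (x y : X) (r : R).

Record is_quasimetric (K : R) : Prop := IsQuasimetric {
  quasi_const_ge1 : 1 <= K;
  quasi_ge0 : forall x y, 0 <= d x y;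
  quasi_eq0 : forall x y, d x y = 0 <-> x = y;
  quasi_sym : forall x y, d x y = d y x;
  quasi_triangle : forall x y z, d x y <= K * (d x z + d z y) }.

Definition qball x r : set X := [set y | d x y < r].

Definition qopen : set (set X) :=
  [set A | forall x, A x -> exists2 r, 0 < r & qball x r `<=` A].

(* The infimum is taken in the extended reals, so that the distance to the
   empty set is +oo. *)
Definition set_dist A y : \bar R := ereal_inf [set (d a y)%:E | a in A].

Definition set_ball A r : set X := [set y | (set_dist A y < r%:E)%E].

(* X with the Borel sigma-algebra of the topology [qopen] *)
Definition borel_space := g_sigma_algebraType qopen.

Definition doubling (vol : set borel_space -> \bar R) (Cd : R) : Prop :=
  forall x r, 0 < r ->
    [/\ (0 < vol (qball x (2 * r)))%E,
        (vol (qball x (2 * r)) <= Cd%:E * vol (qball x r))%E &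
        (Cd%:E * vol (qball x r) < +oo)%E].

(* A space of homogeneous type whose Borel measure is [vol]. *)
Record homogeneous_type (K : R) (vol : {measure set borel_space -> \bar R})
    (Cd : R) : Prop := HomogeneousType {
  homog_quasimetric : is_quasimetric K;
  homog_ball_open : forall x r, 0 < r -> qopen (qball x r);
  homog_doubling : doubling vol Cd }.

(* The part of A, a cube of level n, at distance at most t * q ^ n from the
   complement of A; it is empty when A = X. *)
Definition cube_boundary (q : R) (n : int) (t : R) A : set X :=
  [set x | A x /\ (set_dist (~` A) x <= (t * q ^ n)%:E)%E].

(* [Q n] is the family of cubes of level n, and [m n A] is the center of A as
   a cube of level n: the same set may be a cube of several levels.
   C1 and C2 are inner and outer radii, hence [cubes_radii_le]; it is not
   implied by [cubes_balls], as balls of different radii can coincide. *)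
Record dyadic_cubes (vol : {measure set borel_space -> \bar R})
    (Q : int -> set (set X)) (m : int -> set X -> X)
    (q C1 C2 C3 eta : R) (N : nat) : Prop := DyadicCubes {
  cubes_ratio : 0 < q < 1;
  cubes_inner_gt0 : 0 < C1;
  cubes_outer_gt0 : 0 < C2;
  cubes_radii_le : C1 <= C2;
  cubes_bdry_gt0 : 0 < C3;
  cubes_exp_gt0 : 0 < eta;
  cubes_open : forall n A, Q n A -> qopen A;
  cubes_center : forall n A, Q n A -> A (m n A);
  cubes_cover : forall n, vol.-negligible (~` \bigcup_(A in Q n) A);
  cubes_nested : forall k n A B, (k <= n)%R -> Q k A -> Q n B ->
    B `<=` A \/ A `&` B = set0;
  cubes_ancestor : forall k n B, (k <= n)%R -> Q n B ->
    exists! A, Q k A /\ B `<=` A;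
  cubes_balls : forall n A, Q n A ->
    qball (m n A) (C1 * q ^ n) `<=` A /\ A `<=` qball (m n A) (C2 * q ^ n);
  cubes_boundary : forall n A t, Q n A -> 0 < t ->
    (vol (cube_boundary q n t A) < (C3 * t `^ eta)%:E * vol A)%E;
  cubes_countable : forall n, countable (Q n);
  cubes_children_le : forall n A, Q n A ->
    [set B | Q (n + 1) B /\ B `<=` A] #<= `I_N;
  cubes_children_cover : forall n A, Q n A -> exists F : set (set X),
    [/\ F `<=` Q (n + 1), F #<= `I_N &
        vol.-negligible ((A `\` \bigcup_(B in F) B) `|`
                         ((\bigcup_(B in F) B) `\` A))] }.

End Quasimetric.

Section Leveled.
Variables (R : realType) (X : pointedType).

(* A set together with a level; dyadic cubes and adapted cubes are of this
   kind, so that the same set with two levels counts as two cubes. *)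
Definition lset : Type := int * set X.
Definition lev (A : lset) : int := A.1.
Definition carrier (A : lset) : set X := A.2.

Definition leveled_cubes (Q : int -> set (set X)) : set lset :=
  [set A | Q (lev A) (carrier A)].

Definition star (CC : set lset) : set X := \bigcup_(C in CC) carrier C.

Definition strict_sub (C D : lset) : Prop :=
  carrier C `<=` carrier D /\ (lev D < lev C)%R.

Definition levR (A : lset) : \bar R := ((lev A)%:~R)%:E.

(* The intersection of all D in CC or D = X strictly containing C, X having
   level -oo: the carriers are intersected, and the level is the supremum of
   the levels (the supremum of the empty set is -oo), i.e. that of the
   smallest D. *)
Definition predecessor (CC : set lset) (C : lset) : set X * \bar R :=
  (\bigcap_(D in CC `&` strict_sub C) carrier D,
   ereal_sup [set levR D | D in CC `&` strict_sub C]).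

Lemma predecessor_smallest (CC : set lset) (C D : lset) :
  CC D -> strict_sub C D ->
  (forall D', CC D' -> strict_sub C D' ->
     carrier D `<=` carrier D' /\ lev D' <= lev D) ->
  predecessor CC C = (carrier D, levR D).
Proof.
move=> CD CsD Dmin; congr pair.
  apply/seteqP; split=> [x|x Dx D' [CD' CsD']]; first by apply; split.
  exact: (Dmin _ CD' CsD').1.
apply/eqP; rewrite eq_le; apply/andP; split.
  apply: ge_ereal_sup => _ [D' [CD' CsD'] <-].
  by rewrite lee_fin ler_int; exact: (Dmin _ CD' CsD').2.
by apply: ereal_sup_ubound; exists D.
Qed.

Lemma predecessor_none (CC : set lset) (C : lset) :
  (forall D, CC D -> ~ strict_sub C D) ->
  predecessor CC C = (setT, -oo%E).
Proof.
move=> noD; rewrite /predecessor.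
have -> : CC `&` strict_sub C = set0.
  by apply/seteqP; split=> // D [CD /(noD _ CD)].
by rewrite bigcap_set0 image_set0 ereal_sup0.
Qed.

End Leveled.

(* A collection of sets whose members are pairwise comparable or disjoint *)
Definition nested (X : Type) (CC : set (set X)) : Prop :=
  forall A B, CC A -> CC B -> [\/ A `&` B = A, A `&` B = B | A `&` B = set0].

Section Dilation.
Variables (R : realType) (X : pointedType) (d : X -> X -> R) (q : R).

Definition dilate (r : R) (A : lset X) : set X :=
  set_ball d (carrier A) (r * q ^ lev A).

Definition enlarge (Q : int -> set (set X)) (AA : set (lset X)) (alpha : R) :
    set (lset X) :=
  \bigcup_(A in AA) [set B | [/\ leveled_cubes Q B, lev B = lev A &
                                carrier B `&` dilate alpha A !=set0]].

Definition separated_cubes (CR : R) (AA : set (lset X)) : Prop :=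
  forall A1 A2, AA A1 -> AA A2 -> A1 <> A2 -> lev A1 = lev A2 ->
    dilate CR A1 `&` dilate CR A2 = set0.

End Dilation.

Definition small_successors (R : realType) (X : pointedType) (mu : nat)
    (CC : set (lset X)) : Prop :=
  forall A, CC A ->
    ((mu%:R)%:E + (predecessor R CC A).2 <= levR R A)%E.

(* Main.v *)
Require Import Defs.
From HB Require Import structures.
From mathcomp Require Import all_boot all_order all_algebra.
From mathcomp Require Import all_classical all_reals all_analysis.
From mathcomp Require Import ring zify.

Import Order.TTheory GRing.Theory Num.Theory.

Local Open Scope classical_set_scope.
Local Open Scope ring_scope.

(** The adapted cube of A is built from the small scales up: to A itself add
    the adapted cube of every strictly smaller B (that is, of higher level)
    that meets A or meets the adapted cube of some C in phi A.  Being the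
    least solution of a monotone system of inclusions, this is an inductive
    predicate, [adapted], written sg below.

    Nestedness.  A smaller adapted cube sg B that meets sg A is contained in
    it ([adapted_absorbs]): if it meets A it has been added; otherwise it meets
    some added sg C, and, the smaller adapted cubes being already known to be
    comparable or disjoint, it either lies in sg C or contains it, hence meets
    whatever caused sg C to be added, and has itself been added.  Adapted cubes
    of equal level are disjoint by the separation condition once sg A lies in
    the CR-dilate of A.

    Confinement.  Let s be the scale of A.  Every added cube sg B lies in an
    sg E, with E smaller than A, that contains a point z at distance less
    than CR / (2 * K) * s from A: take z in A if sg B meets A, and otherwise
    the center of the C in phi A that sg B is attached to, with E the one of B
    and C whose adapted cube is the larger.  Now sg E has diameter at most
    2 * K ^ 2 * (C2 + CR) times the scale of E, so the center of E lies in the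
    alpha-dilate of A.  Its ancestor at the level of A then belongs to the
    enlarged collection, as does E, and the small successor condition puts E
    at least mu levels below A ([level_gap]).  At that scale the diameter of
    sg E is at most CR / (2 * K) * s ([scale_gap]), so all of sg E is within
    CR * s of A ([near_sub_dilate]).

    Both properties of A use those of all smaller cubes; they are proved
    together, by induction from the highest level down
    ([adapted_confined_absorbing]).  The volume bound follows from
    confinement: sg A lies in a ball concentric with a ball contained in A,
    with radius K * (C2 + CR) / C1 times as large, and doubling the radius
    costs a factor Cd ([qball_vol_growth]). *)

(** * Induction on levels *)

Section DownwardInduction.
Context {X : pointedType}.

(** The levels occurring in a finite collection are bounded above, which makes
    the order from small cubes to large ones well founded. *)
Lemma finite_level_ind {AA : set (lset X)} {P : lset X -> Prop} :
  finite_set AA ->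
  (forall A, AA A -> (forall B, AA B -> lev A < lev B -> P B) -> P A) ->
  forall A, AA A -> P A.
Proof.
move=> finAA IH.
have [M leM] : exists M : int, forall A, AA A -> lev A <= M.
  have /finite_seqP[s sE] : finite_set [set lev A | A in AA].
    exact: finite_image.
  exists (\big[Order.max/0]_(i <- s) i) => A AAA.
  have As : lev A \in s by have : [set` s] (lev A) by rewrite -sE; exists A.
  exact: (le_bigmax_seq _ _ _ id).
have IHn n : forall A, AA A -> M - lev A < n%:Z -> P A.
  elim: n => [|n IHn] A AAA ltA.
    by have := leM _ AAA; lia.
  by apply: IH => // B AAB ltAB; apply: IHn => //; lia.
move=> A AAA; apply: (IHn `|M - lev A|.+1 A AAA).
by have := leM _ AAA; lia.
Qed.

End DownwardInduction.

(** * Adapted sets and absorption *)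

Section AdaptedSets.
Context {X : pointedType} (AA : set (lset X)) (phi : lset X -> set (lset X)).

(** In [adapted_absorb], y is where the adapted cube of B touches A or the
    adapted cube of some C in phi A, which is why all of it is added. *)
Inductive adapted : lset X -> X -> Prop :=
| adapted_cube A x : carrier A x -> adapted A x
| adapted_absorb A B x y :
    AA B -> lev A < lev B -> adapted B x -> adapted B y ->
    carrier A y \/ (exists2 C, phi A C & adapted C y) -> adapted A x.

Lemma adapted_inv (A : lset X) x : adapted A x ->
  carrier A x \/ exists B y, [/\ AA B, lev A < lev B, adapted B x, adapted B y &
    carrier A y \/ exists2 C, phi A C & adapted C y].
Proof. by case=> [{}A {}x ?|{}A B {}x y *]; [left|right; exists B, y]. Qed.

Lemma adapted_sub_phi (A C : lset X) : AA C -> lev A < lev C -> phi A C ->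
  adapted C `<=` adapted A.
Proof.
move=> AAC ltAC AC x Cx; apply: (@adapted_absorb A C x x) => //.
by right; exists C.
Qed.

Definition comparable_above (A : lset X) := forall B C,
  AA B -> AA C -> lev A < lev B -> lev A < lev C ->
  adapted B `&` adapted C !=set0 ->
  adapted B `<=` adapted C \/ adapted C `<=` adapted B.

(** Whatever causes C to be absorbed by A also causes the absorption of any
    adapted cube that contains that of C. *)
Lemma adapted_absorbs (A B : lset X) :
  comparable_above A -> AA B -> lev A < lev B ->
  adapted A `&` adapted B !=set0 -> adapted B `<=` adapted A.
Proof.
move=> cmpA AAB ltAB [y [/adapted_inv[Ay|]]].
  by move=> By x Bx; apply: (@adapted_absorb A B x y) => //; left.
move=> [C [z [AAC ltAC Cy Cz Az]]] By.
have [BC|CB] : adapted B `<=` adapted C \/ adapted C `<=` adapted B.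
  by apply: cmpA => //; exists y.
- by move=> x /BC Cx; apply: (@adapted_absorb A C x z).
- by move=> x Bx; apply: (@adapted_absorb A B x z) => //; exact: CB.
Qed.

End AdaptedSets.

(** * Quasimetrics, dilations and open sets *)

Section QuasimetricFacts.
Context {R : realType} {X : pointedType} {d : X -> X -> R} {K : R}.
Hypothesis dK : is_quasimetric d K.

Lemma quasi_const_gt0 : 0 < K.
Proof. exact: lt_le_trans ltr01 (quasi_const_ge1 dK). Qed.

Lemma quasi_refl x : d x x = 0.
Proof. exact/(quasi_eq0 dK). Qed.

Lemma quasi_triangle_lt x y z r s :
  d x z < r -> d z y < s -> d x y < K * (r + s).
Proof.
move=> xz zy; apply: le_lt_trans (quasi_triangle dK x y z) _.
by rewrite ltr_pM2l ?quasi_const_gt0// ltrD.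
Qed.

Lemma dilateP q r (A : lset X) y : dilate d q r A y <->
  exists2 a, carrier A a & d a y < r * q ^ lev A.
Proof.
split=> [/ereal_inf_lt[_ [a Aa <-]]|[a Aa ay]].
  by rewrite lte_fin; exists a.
rewrite /dilate /set_ball /set_dist /=.
apply: (@le_lt_trans _ _ (d a y)%:E); last by rewrite lte_fin.
by apply: ereal_inf_lbound; exists a.
Qed.

End QuasimetricFacts.

Lemma qopen_measurable {R : realType} {X : pointedType} (d : X -> X -> R)
    (U : set X) : qopen d U -> measurable (U : set (borel_space d)).
Proof. by move=> oU; apply: sub_sigma_algebra. Qed.

(** * Volume growth of balls *)

Section DoublingGrowth.
Context {R : realType} {X : pointedType} {d : X -> X -> R} {K : R}
  {vol : {measure set (borel_space d) -> \bar R}} {Cd : R}.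
Hypothesis hX : homogeneous_type K vol Cd.

Lemma measurable_qball x r : 0 < r ->
  measurable (qball d x r : set (borel_space d)).
Proof. by move=> r0; apply: qopen_measurable; exact: (homog_ball_open hX). Qed.


Lemma le_qball_vol x r s : 0 < r -> r <= s ->
  (vol (qball d x r) <= vol (qball d x s))%E.
Proof.
move=> r0 rs; apply: le_measure; rewrite ?inE.
- exact: measurable_qball.
- by apply: measurable_qball; exact: lt_le_trans rs.
- by move=> y yr; apply: lt_le_trans yr rs.
Qed.

Lemma qball_vol_gt0 x r : 0 < r -> (0 < vol (qball d x r))%E.
Proof.
move=> r0; have r20 : 0 < r / 2 by rewrite divr_gt0.
have [+ _ _] := homog_doubling hX x r20.
by rewrite (_ : 2 * (r / 2) = r)//; field.
Qed.

(** Otherwise a ball would have smaller volume than its half-size part. *)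
Lemma doubling_const_ge1 : 1 <= Cd.
Proof.
have [B2_gt0 B2_le CB_fin] := homog_doubling hX point ltr01.
have B_gt0 := @qball_vol_gt0 point 1 ltr01.
have Cd_gt0 : (0 < Cd%:E)%E.
  by rewrite -(pmule_lgt0 _ B_gt0); exact: lt_le_trans B2_le.
have B_fin : vol (qball d point 1) \is a fin_num.
  rewrite ge0_fin_numE ?ltW// ltNge leye_eq; apply/negP => /eqP BE.
  by move: CB_fin; rewrite BE gt0_muley.
rewrite -lee_fin -(lee_pmul2r B_fin B_gt0) mul1e; apply: le_trans B2_le.
by apply: le_qball_vol; rewrite ?mulr1// ler1n.
Qed.

Lemma qball_vol_iter x r k : 0 < r ->
  (vol (qball d x (2 ^+ k * r)) <= (Cd ^+ k)%:E * vol (qball d x r))%E.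
Proof.
move=> r0; elim: k => [|k IHk]; first by rewrite !expr0 mul1r mul1e.
rewrite exprS -mulrA exprS EFinM -muleA.
have r'0 : 0 < 2 ^+ k * r by rewrite mulr_gt0 ?exprn_gt0.
have [_ /le_trans + _] := homog_doubling hX x r'0; apply.
by apply: lee_wpmul2l => //;
  rewrite lee_fin (le_trans ler01 doubling_const_ge1).
Qed.

(** With k least such that t <= 2 ^ k, the iterated bound is
    Cd ^ k = Cd * (2 ^ k.-1) `^ log2 Cd, and 2 ^ k.-1 <= t by minimality. *)
Lemma qball_vol_growth x r t : 0 < r -> 1 <= t ->
  (vol (qball d x (t * r)) <=
    (Cd * t `^ (ln Cd / ln 2))%:E * vol (qball d x r))%E.
Proof.
move=> r0 t1.
have Cd1 := doubling_const_ge1; have Cd0 : 0 < Cd := lt_le_trans ltr01 Cd1.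
have p0 : 0 <= ln Cd / ln 2 :> R by rewrite divr_ge0 ?ln_ge0 ?ler1n.
have ex_k : exists k, t <= 2 ^+ k.
  exists (Num.trunc t).+1; apply/ltW/(lt_trans (truncnS_gt t)).
  by rewrite -natrX ltr_nat ltn_expl.
case: (ex_minnP ex_k) => k tk k_min.
apply: (@le_trans _ _ (vol (qball d x (2 ^+ k * r)))).
  apply: le_qball_vol.
    by rewrite mulr_gt0// (lt_le_trans ltr01).
  by rewrite ler_pM2r.
apply: le_trans (qball_vol_iter x _ k r0) _.
apply: lee_wpmul2r => //; rewrite lee_fin.
(* k = 0 has no predecessor; then Cd ^ 0 = 1 is bounded directly *)
case: k => [|k] in tk k_min *.
  rewrite expr0 mulr_ege1// -[leLHS](powRr0 t) ler_powR//.
rewrite exprS ler_pM2l//.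
have -> : Cd ^+ k = (2 ^+ k) `^ (ln Cd / ln 2).
  rewrite -!powR_mulrn// ?(ltW Cd0)// -powRrM mulrC powRrM; congr (_ `^ _).
  by rewrite /powR pnatr_eq0/= divfK ?lnK// gt_eqF// ln_gt0// ltr1n.
apply: ge0_ler_powR => //; rewrite ?nnegrE ?exprn_ge0// ?(le_trans ler01)//.
by rewrite leNgt; apply/negP => /ltW /k_min; rewrite ltnn.
Qed.

End DoublingGrowth.

(** * Adapted cubes in a dyadic system *)

Section AdaptedCubes.
Context {R : realType} {X : pointedType} {d : X -> X -> R}
  {K : R} {vol : {measure set (borel_space d) -> \bar R}} {Cd : R}.
Hypothesis hX : homogeneous_type K vol Cd.
Context {Q : int -> set (set X)} {m : int -> set X -> X}
  {q C1 C2 C3 eta : R} {N : nat}.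
Hypothesis hQ : dyadic_cubes vol Q m q C1 C2 C3 eta N.
Context {CR : R} {mu : nat}.
Hypothesis hCR : 0 < CR.
Hypothesis hmu : 4 * K ^+ 3 * (1 + C2 / CR) * q ^+ mu <= 1.
Context {AA : set (lset X)}.
Hypothesis hAQ : AA `<=` leveled_cubes Q.
Hypothesis hAfin : finite_set AA.
Hypothesis hsep : separated_cubes d q CR AA.
Let alpha := 2 * K ^+ 3 * (C2 + CR) + CR / 2.
Hypothesis hsucc : small_successors R mu (enlarge d q Q AA alpha).
Context {phi : lset X -> set (lset X)}.
Hypothesis hphiA : forall A, AA A -> phi A `<=` AA.
Hypothesis hphilev : forall A B, AA A -> phi A B -> lev A < lev B.
Hypothesis hphisub : forall A, AA A ->
  star (phi A) `<=` dilate d q (CR / (2 * K)) A.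

Local Notation sg := (adapted AA phi).
Let dK := homog_quasimetric hX.
Let K_gt0 : 0 < K := quasi_const_gt0 dK.
Let q_gt0 : 0 < q. Proof. by have /andP[] := cubes_ratio hQ. Qed.
Let C1_gt0 := cubes_inner_gt0 hQ.
Let C2_gt0 := cubes_outer_gt0 hQ.
Let scale_gt0 (A : lset X) : 0 < q ^ lev A := exprz_gt0 (lev A) q_gt0.

Definition center (A : lset X) : X := m (lev A) (carrier A).

Lemma center_in {A} : AA A -> carrier A (center A).
Proof. by move=> /hAQ; exact: (cubes_center hQ). Qed.

Lemma cube_sub_qball {A} : AA A ->
  carrier A `<=` qball d (center A) (C2 * q ^ lev A).
Proof. by move=> /hAQ /(cubes_balls hQ)[]. Qed.

Lemma qball_sub_cube {A} : AA A ->
  qball d (center A) (C1 * q ^ lev A) `<=` carrier A.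
Proof. by move=> /hAQ /(cubes_balls hQ)[]. Qed.

Lemma scale_le {j k : int} : j <= k -> q ^ k <= q ^ j.
Proof.
move=> jk; have [n ->] : exists n : nat, k = j + n%:Z.
  by exists `|k - j|%N; lia.
rewrite expfzDr ?gt_eqF// ler_piMr ?(ltW (exprz_gt0 _ _))//.
have /andP[_ q1] := cubes_ratio hQ.
by rewrite exprn_ile1// ltW.
Qed.

(** The left-hand side bounds the diameter of an adapted cube of level k
    ([dilate_diam]); the inequality is the condition on mu, multiplied by
    CR / (2 * K) * q ^ j. *)
Lemma scale_gap {j k : int} : j + mu%:Z <= k ->
  2 * K ^+ 2 * (C2 + CR) * q ^ k <= CR / (2 * K) * q ^ j.
Proof.
move=> jk.
apply: (@le_trans _ _ (2 * K ^+ 2 * (C2 + CR) * (q ^ j * q ^+ mu))).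
  rewrite ler_pM2l; last by rewrite !mulr_gt0 ?exprn_gt0 ?addr_gt0.
  by apply: le_trans (scale_le jk) _; rewrite expfzDr ?gt_eqF.
have -> : 2 * K ^+ 2 * (C2 + CR) * (q ^ j * q ^+ mu) =
    (4 * K ^+ 3 * (1 + C2 / CR) * q ^+ mu) * (CR / (2 * K) * q ^ j).
  by field; rewrite !gt_eqF.
by rewrite ler_piMl// ltW// mulr_gt0 ?exprz_gt0// divr_gt0// mulr_gt0.
Qed.

Lemma dilate_sub_qball {A} : AA A ->
  dilate d q CR A `<=` qball d (center A) (K * (C2 + CR) * q ^ lev A).
Proof.
move=> AAA x /dilateP[a Aa ax].
by rewrite /qball/= -mulrA mulrDl; apply: (quasi_triangle_lt dK) ax;
  exact: cube_sub_qball.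
Qed.

Lemma dilate_diam {A} {x y : X} : AA A -> dilate d q CR A x ->
  dilate d q CR A y -> d x y < 2 * K ^+ 2 * (C2 + CR) * q ^ lev A.
Proof.
move=> AAA /(dilate_sub_qball AAA) cx /(dilate_sub_qball AAA) cy.
have -> : 2 * K ^+ 2 * (C2 + CR) * q ^ lev A =
    K * (K * (C2 + CR) * q ^ lev A + K * (C2 + CR) * q ^ lev A) by ring.
by apply: (quasi_triangle_lt dK) cy; rewrite (quasi_sym dK).
Qed.

Lemma alpha_gt0 : 0 < alpha.
Proof. by rewrite addr_gt0 ?divr_gt0// !mulr_gt0 ?exprn_gt0 ?addr_gt0. Qed.

(** The ancestor of B at the level of A contains b, so it belongs to the
    enlarged collection; as it strictly contains B, the predecessor of B has at
    least the level of A. *)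
Lemma level_gap {A B} {b : X} : AA A -> AA B -> lev A < lev B -> carrier B b ->
  dilate d q alpha A b -> lev A + mu%:Z <= lev B.
Proof.
move=> AAA AAB ltAB Bb alb.
have [D [[QD BD] _]] := cubes_ancestor hQ (ltW ltAB) (hAQ _ AAB).
have enlB : enlarge d q Q AA alpha B.
  exists B => //; split => //; first exact: hAQ.
  exists b; split => //; apply/dilateP; exists b => //.
  by rewrite (quasi_refl dK) mulr_gt0 ?alpha_gt0.
have enlD : enlarge d q Q AA alpha (lev A, D).
  by exists A => //; split => //; exists b; split => //; exact: BD.
have := hsucc _ enlB; rewrite -(ler_int R) intrD -lee_fin EFinD.
apply: le_trans; rewrite addeC; apply: leeD2l.
by apply: ereal_sup_ubound; exists (lev A, D).
Qed.

(** A priori the diameter of the adapted cube of E is only controlled at the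
    scale of A, which puts E in the alpha-dilate of A; the resulting gap of mu
    levels then shrinks the bound to CR / (2 * K) times that scale. *)
Lemma near_sub_dilate {A E} {a z : X} :
  AA A -> AA E -> lev A < lev E -> sg E `<=` dilate d q CR E ->
  carrier A a -> sg E z -> d a z < CR / (2 * K) * q ^ lev A ->
  sg E `<=` dilate d q CR A.
Proof.
move=> AAA AAE ltAE subE Aa Ez az x Ex.
have Ec := adapted_cube AA phi _ _ (center_in AAE).
have gap : lev A + mu%:Z <= lev E.
  apply: (level_gap AAA AAE ltAE (center_in AAE)).
  apply/dilateP; exists a => //.
  (* alpha is the radius that the quasi-triangle inequality gives here *)
  have -> : alpha * q ^ lev A = K * (CR / (2 * K) * q ^ lev A +
      2 * K ^+ 2 * (C2 + CR) * q ^ lev A).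
    by rewrite /alpha; field; rewrite gt_eqF.
  apply: (quasi_triangle_lt dK) az _.
  apply: lt_le_trans (dilate_diam AAE (subE _ Ez) (subE _ Ec)) _.
  by rewrite ler_pM2l ?scale_le ?(ltW ltAE)// !mulr_gt0 ?exprn_gt0 ?addr_gt0.
apply/dilateP; exists a => //.
have -> : CR * q ^ lev A =
    K * (CR / (2 * K) * q ^ lev A + CR / (2 * K) * q ^ lev A).
  by field; rewrite gt_eqF.
apply: (quasi_triangle_lt dK) az _; apply: lt_le_trans (scale_gap gap).
exact: dilate_diam (subE _ Ez) (subE _ Ex).
Qed.

(** Each absorbed cube lies in an adapted cube to which [near_sub_dilate]
    applies. *)
Lemma adapted_sub_dilate_step {A} : AA A -> comparable_above AA phi A ->
  (forall B, AA B -> lev A < lev B -> sg B `<=` dilate d q CR B) ->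
  sg A `<=` dilate d q CR A.
Proof.
move=> AAA cmpA subA x /adapted_inv[Ax|].
  by apply/dilateP; exists x => //; rewrite (quasi_refl dK) mulr_gt0.
move=> [B [y [AAB ltAB Bx By]]] [Ay|[C AC Cy]].
  apply: (near_sub_dilate AAA AAB ltAB (subA _ AAB ltAB) Ay By) Bx.
  by rewrite (quasi_refl dK) mulr_gt0// divr_gt0// mulr_gt0.
have [AAC ltAC] := (hphiA _ AAA _ AC, hphilev _ _ AAA AC).
(* the center of C is close to A and lies in both candidates for E *)
have [|a Aa ac] := (dilateP _ _ _ _).1 (hphisub _ AAA (center C) _).
  by exists C => //; exact: center_in.
have Cc := adapted_cube AA phi _ _ (center_in AAC).
have [BC|CB] : sg B `<=` sg C \/ sg C `<=` sg B by apply: cmpA => //; exists y.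
- exact: (near_sub_dilate AAA AAC ltAC (subA _ AAC ltAC) Aa Cc ac) (BC _ Bx).
- exact: (near_sub_dilate AAA AAB ltAB (subA _ AAB ltAB) Aa (CB _ Cc) ac) Bx.
Qed.

(** Confinement of the smaller cubes separates those of equal level, so with
    their absorption they are pairwise comparable or disjoint; this is what
    confinement and absorption for A rest on. *)
Lemma adapted_confined_absorbing A : AA A ->
  sg A `<=` dilate d q CR A /\ (forall B, AA B -> lev A < lev B ->
    sg A `&` sg B !=set0 -> sg B `<=` sg A).
Proof.
move: A; apply: (finite_level_ind hAfin) => A AAA IH.
suff cmpA : comparable_above AA phi A.
  split; last by move=> B AAB ltAB; exact: adapted_absorbs.
  by apply: adapted_sub_dilate_step => // B AAB /(IH _ AAB)[].
move=> B C AAB AAC ltAB ltAC BC.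
have [subB absB] := IH _ AAB ltAB; have [subC absC] := IH _ AAC ltAC.
have [ltBC|ltCB|eqBC] := ltgtP (lev B) (lev C).
- by right; exact: absB.
- by left; apply: absC => //; rewrite setIC.
- have [<-|neqBC] := pselect (B = C); first by left.
  case: BC => x [/subB Bx /subC Cx]; exfalso.
  by have : (dilate d q CR B `&` dilate d q CR C) x by []; rewrite hsep.
Qed.

Lemma adapted_sub_dilate {A} : AA A -> sg A `<=` dilate d q CR A.
Proof. by move=> /adapted_confined_absorbing[]. Qed.

Lemma adapted_same_level {A B} : AA A -> AA B -> lev A = lev B ->
  sg A `&` sg B !=set0 -> A = B.
Proof.
move=> AAA AAB eqAB [x [Ax Bx]]; apply: contrapT => neqAB.
have : (dilate d q CR A `&` dilate d q CR B) x.
  by split; exact: adapted_sub_dilate.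
by rewrite hsep.
Qed.

Lemma adapted_comparable {A B} : AA A -> AA B -> sg A `&` sg B !=set0 ->
  sg A `<=` sg B \/ sg B `<=` sg A.
Proof.
move=> AAA AAB AB; have [ltAB|ltBA|eqAB] := ltgtP (lev A) (lev B).
- by right; exact: (adapted_confined_absorbing _ AAA).2.
- by left; apply: (adapted_confined_absorbing _ AAB).2 => //; rewrite setIC.
- by rewrite (adapted_same_level AAA AAB eqAB AB); left.
Qed.

Lemma adapted_qopen {A} : AA A -> qopen d (sg A).
Proof.
move: A; apply: (finite_level_ind hAfin) => A AAA IH x /adapted_inv[Ax|].
  have [r r0 xr] := cubes_open hQ (hAQ _ AAA) Ax.
  by exists r => // y /xr; exact: adapted_cube.
move=> [B [y [AAB ltAB Bx By Ay]]].
have [r r0 xr] := IH B AAB ltAB x Bx.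
by exists r => // w /xr Bw; exact: (adapted_absorb AA phi A B w y).
Qed.

Lemma vol_adapted {A} : AA A ->
  (vol (sg A) <= (Cd * (K * (C2 + CR) / C1) `^ (ln Cd / ln 2))%:E *
    vol (carrier A))%E.
Proof.
move=> AAA.
have mqball := measurable_qball hX (center A).
have r_gt0 : 0 < C1 * q ^ lev A by rewrite mulr_gt0.
apply: (@le_trans _ _ (vol (qball d (center A) (K * (C2 + CR) * q ^ lev A)))).
  apply: le_measure; rewrite ?inE.
  - by apply: qopen_measurable; exact: adapted_qopen.
  - by apply: mqball; rewrite !mulr_gt0// addr_gt0.
  - exact: subset_trans (adapted_sub_dilate AAA) (dilate_sub_qball AAA).
have -> : K * (C2 + CR) * q ^ lev A =
    K * (C2 + CR) / C1 * (C1 * q ^ lev A) by field; rewrite gt_eqF.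
apply: le_trans (qball_vol_growth hX (center A) _ _ r_gt0 _) _.
  rewrite ler_pdivlMr// mul1r; apply: le_trans (cubes_radii_le hQ) _.
  apply: (@le_trans _ _ (C2 + CR)); first by rewrite lerDl ltW.
  by rewrite ler_peMl ?(quasi_const_ge1 dK)// ltW// addr_gt0.
apply: lee_wpmul2l.
  rewrite lee_fin mulr_ge0 ?powR_ge0//.
  exact: le_trans ler01 (doubling_const_ge1 hX).
apply: le_measure; rewrite ?inE.
- exact: mqball.
- by apply: qopen_measurable; exact: cubes_open hQ _ _ (hAQ _ AAA).
- exact: qball_sub_cube.
Qed.

End AdaptedCubes.


Theorem theorem3p1 (R : realType) (X : pointedType) (d : X -> X -> R)
    (K : R) (vol : {measure set (borel_space d) -> \bar R}) (Cd : R)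
    (hX : homogeneous_type K vol Cd)
    (Q : int -> set (set X)) (m : int -> set X -> X)
    (q C1 C2 C3 eta : R) (N : nat)
    (hQ : dyadic_cubes vol Q m q C1 C2 C3 eta N)
    (CR : R) (mu : nat)
    (hCR : 0 < CR)
    (hmu : 4 * K ^+ 3 * (1 + C2 / CR) * q ^+ mu <= 1)
    (AA : set (lset X))
    (hAQ : AA `<=` leveled_cubes Q)
    (hAfin : finite_set AA)
    (hsep : separated_cubes d q CR AA)
    (hsucc : small_successors R mu
       (enlarge d q Q AA (2 * K ^+ 3 * (C2 + CR) + CR / 2)))
    (phi : lset X -> set (lset X))
    (hphiA : forall A, AA A -> phi A `<=` AA)
    (hphilev : forall A B, AA A -> phi A B -> lev A < lev B)
    (hphisub : forall A, AA A ->
       star (phi A) `<=` dilate d q (CR / (2 * K)) A) :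
  exists (BB : set (lset X)) (sigma : lset X -> lset X),
    [/\ set_bij AA BB sigma,
        forall A, AA A ->
          [/\ lev (sigma A) = lev A,
              carrier A `|` star (sigma @` phi A) `<=` carrier (sigma A),
              carrier (sigma A) `<=` dilate d q CR A,
              measurable (carrier (sigma A) : set (borel_space d)) &
              (vol (carrier (sigma A)) <=
                (Cd * (K * (C2 + CR) / C1) `^ (ln Cd / ln 2))%:E *
                vol (carrier A))%E] &
        nested [set carrier B | B in BB]].
Proof.
(* keeping the level in sigma A lets separation give injectivity *)
pose sigma (A : lset X) : lset X := (lev A, adapted AA phi A).
exists (sigma @` AA), sigma; split.
- apply: inj_bij => A B; rewrite !inE => AAA AAB [eq_lev eq_carrier].
  apply: (adapted_same_level hX hQ hCR hmu hAQ hAfin hsep hsucc hphiA hphilev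
    hphisub AAA AAB eq_lev).
  rewrite -eq_carrier setIid; exists (m (lev A) (carrier A)).
  by apply: adapted_cube; exact: (center_in hQ hAQ AAA).
- move=> A AAA; split=> //.
  + move=> x [Ax|[_ [C AC <-] Cx]]; first exact: adapted_cube.
    exact: adapted_sub_phi (hphiA _ AAA _ AC) (hphilev _ _ AAA AC) AC _ Cx.
  + exact: (adapted_sub_dilate hX hQ hCR hmu hAQ hAfin hsep hsucc hphiA hphilev
      hphisub AAA).
  + exact: qopen_measurable (adapted_qopen hQ hAQ hAfin AAA).
  + exact: (vol_adapted hX hQ hCR hmu hAQ hAfin hsep hsucc hphiA hphilev
      hphisub AAA).
- move=> _ _ [_ [A AAA <-] <-] [_ [B AAB <-] <-] /=.
  have [AB|AB0] := pselect (adapted AA phi A `&` adapted AA phi B !=set0).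
    have [/setIidPl ?|/setIidPr ?] := adapted_comparable hX hQ hCR hmu hAQ
      hAfin hsep hsucc hphiA hphilev hphisub AAA AAB AB.
    + exact: Or31.
    + exact: Or32.
  by apply: Or33; apply: contrapT => /eqP/set0P.
Qed.
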